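(* Let $k\ge 1$ be an integer and let $G$ be a twin-free weighted graph. The column space of $N(k,G)$ (the linear span of its columns in $\mathbf{R}^{V(G)^k}$) consists of precisely those vectors $f:V(G)^k\to\mathbf{R}$ that are invariant under automorphisms of $G$.
   Context: A weighted graph $G$ consists of a finite node set $V(G)$, a positive real weight $\alpha_G(i)$ for each node $i$, and a real weight $\beta_{ij}=\beta_G(i,j)=\beta_G(j,i)$ for each pair of nodes $i,j$ (including loops $i=j$; a missing edge is the same as an edge of weight $0$). Two nodes $i,j\in V(G)$ are twins if $\beta_{il}=\beta_{jl}$ for every $l\in V(G)$ (including $l=i$ and $l=j$; node weights play no role). $G$ is twin-free if no two different nodes are twins. An automorphism of $G$ is a permutation $\sigma$ of $V(G)$ preserving node weights and edge weights: $\alpha_G(\sigma(i))=\alpha_G(i)$ and $\beta_{\sigma(i)\sigma(j)}=\beta_{ij}$ for all $i,j$; $\mathrm{Aut}(G)$ is the group of automorphisms. Elements of $V(G)^k$ are viewed as maps $\phi:\{1,\dots,k\}\to V(G)$, and $\phi\sigma$ denotes the map $i\mapsto\sigma(\phi(i))$. A vector $f:V(G)^k\to\mathbf{R}$ is invariant under automorphisms of $G$ if $f(\phi\sigma)=f(\phi)$ for every $\phi\in V(G)^k$ and every $\sigma\in\mathrm{Aut}(G)$. A $k$-labeled graph is a finite unweighted graph (multiple edges allowed, no loops) in which $k$ distinct nodes are labeled $1,\dots,k$ (with any number of unlabeled nodes). For a $k$-labeled graph $F$ and a map $\phi:\{1,\dots,k\}\to V(G)$, define $$\hom_\phi(F,G)=\sum_{\psi}\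 \prod_{u\in V(F)\text{ unlabeled}}\alpha_G(\psi(u))\prod_{uv\in E(F)}\beta_G(\psi(u),\psi(v)),$$ where the sum is over all maps $\psi:V(F)\to V(G)$ extending $\phi$ (i.e. sending the node labeled $i$ to $\phi(i)$ for each $i$), and edges are taken with multiplicity. $N(k,G)$ is the matrix whose rows are indexed by maps $\phi:\{1,\dots,k\}\to V(G)$, whose columns are indexed by $k$-labeled graphs $F$ (up to label-preserving isomorphism), and whose $(\phi,F)$ entry is $\hom_\phi(F,G)$. *)

(* Defs.v *)
From HB Require Import structures.
From mathcomp Require Import all_boot all_order all_algebra all_fingroup.
From mathcomp Require Import reals.

Set Implicit Arguments.
Unset Strict Implicit.
Unset Printing Implicit Defensive.

Import Order.TTheory GRing.Theory Num.Theory.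
Local Open Scope ring_scope.

Record wgraph (R : realType) := WGraph {
  wnode :> finType;
  nodewt : wnode -> R;
  edgewt : wnode -> wnode -> R;
  nodewt_gt0 : forall i, 0 < nodewt i;
  edgewt_sym : forall i j, edgewt i j = edgewt j i
}.

Definition twins (R : realType) (G : wgraph R) (i j : G) : Prop :=
  forall l : G, edgewt i l = edgewt j l.

Definition twin_free (R : realType) (G : wgraph R) : Prop :=
  forall i j : G, i != j -> ~ twins i j.

Definition wgraph_aut (R : realType) (G : wgraph R) : {set {perm G}} :=
  [set s : {perm G} |
     [forall i, nodewt (s i) == nodewt i] &&
     [forall i, forall j, edgewt (s i) (s j) == edgewt i j]].

Lemma wgraph_aut_group_set (R : realType) (G : wgraph R) :
  group_set (wgraph_aut G).
Proof.
apply/group_setP; split=> [|s t].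
  rewrite inE; apply/andP; split; apply/forallP=> i; first by rewrite perm1.
  by apply/forallP=> j; rewrite !perm1.
rewrite !inE => /andP[/forallP sa /forallP sb] /andP[/forallP ta /forallP tb].
apply/andP; split; apply/forallP=> i.
  by rewrite permM (eqP (ta _)) (eqP (sa _)).
apply/forallP=> j.
by rewrite !permM (eqP (forallP (tb _) _)) (eqP (forallP (sb _) _)).
Qed.

Canonical wgraph_aut_group (R : realType) (G : wgraph R) :=
  Group (wgraph_aut_group_set G).

(* Multigraphs have a finite type of edges, so parallel edges are distinct    *)
(* elements with the same endpoints.  The order of the two endpoints of an    *)
(* edge carries no information: edges are only ever evaluated through the     *)
(* symmetric function edgewt.                                                 *)
Record klgraph (k : nat) := KLGraph {
  klnode :> finType;
  kledge : finType;
  klends : kledge -> klnode * klnode;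
  kllabel : 'I_k -> klnode;
  klends_neq : forall e, (klends e).1 != (klends e).2;
  kllabel_inj : injective kllabel
}.

Definition hom (R : realType) (k : nat) (G : wgraph R)
    (phi : {ffun 'I_k -> G}) (F : klgraph k) : R :=
  \sum_(psi : {ffun F -> G} | [forall i : 'I_k, psi (kllabel F i) == phi i])
    (\prod_(u : F | u \notin codom (@kllabel k F)) nodewt (psi u)) *
    \prod_(e : kledge F) edgewt (psi (klends e).1) (psi (klends e).2).

(* Columns are indexed by k-labeled graphs themselves instead of by their     *)
(* isomorphism classes; this repeats columns, which does not affect the span. *)
Definition Ncol (R : realType) (k : nat) (G : wgraph R) (F : klgraph k) :
    {ffun {ffun 'I_k -> G} -> R^o} :=
  [ffun phi => hom phi F].

(* The span of the infinite family of all columns is the union of the spans   *)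
(* of its finite subfamilies.                                                 *)
Definition in_column_space (R : realType) (k : nat) (G : wgraph R)
    (f : {ffun {ffun 'I_k -> G} -> R^o}) : Prop :=
  exists Fs : seq (klgraph k), f \in <<[seq Ncol G F | F <- Fs]>>%VS.

Definition aut_invariant (R : realType) (k : nat) (G : wgraph R)
    (f : {ffun {ffun 'I_k -> G} -> R^o}) : Prop :=
  forall (phi : {ffun 'I_k -> G}) (s : {perm G}),
    s \in wgraph_aut G -> f [ffun i => s (phi i)] = f phi.

(* Main.v *)
Require Import Defs.
From HB Require Import structures.
From mathcomp Require Import all_boot all_order all_algebra all_fingroup.
From mathcomp Require Import boolp reals.

(** The columns are closed under pointwise product (glue two graphs along their
    labels), so their span is a unital algebra of functions on the finite set
    of maps [phi : 'I_k -> G].  Call two maps indistinguishable when all columns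
    agree on them.  Such an algebra consists of all functions that are constant
    on indistinguishability classes ([indist_spanned]), so everything reduces
    to showing that indistinguishable maps [phi], [psi] differ by an
    automorphism of [G].

    The tool for that is unlabeling: if [h] is in the span for [k.+1] labels,
    then [phi |-> \sum_v nodewt v * h (phi, v)] is in the span for [k] labels.
    Taking for [h] the indicator of the class of [(phi, v)], and using that node
    weights are positive, any extension [(phi, v)] of [phi] is indistinguishable
    from some extension [(psi, w)] of [psi] ([indist_extend]).  Comparing edges
    between the new label and old ones, twin-freeness gives that [phi i = phi j]
    exactly when [psi i = psi j] ([indist_eq]).  By extension, [phi] may be
    assumed surjective; then [phi i |-> psi i] is a well-defined permutation
    of [G].  It preserves edge weights because single edges between labels are
    columns, and node weights because the unlabeled sum above, for [h] the
    indicator of the class of [(phi, u)], has a single nonzero term both at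
    [phi] and at [psi] ([indist_surj_aut]). *)

Set Implicit Arguments.
Unset Strict Implicit.
Unset Printing Implicit Defensive.

Import Order.TTheory GRing.Theory Num.Theory.
Local Open Scope ring_scope.

(** * Column vectors are invariant *)

Lemma hom_aut (R : realType) (k : nat) (G : wgraph R) (F : klgraph k)
    (phi : {ffun 'I_k -> G}) (s : {perm G}) :
  s \in wgraph_aut G -> Defs.hom [ffun i => s (phi i)] F = Defs.hom phi F.
Proof.
rewrite inE => /andP[/forallP sN /forallP sE].
pose act (t : {perm G}) (psi : {ffun F -> G}) := [ffun x => t (psi x)].
rewrite /Defs.hom (reindex (act s)) /=; last first.
  by exists (act s^-1%g) => psi _; apply/ffunP => x; rewrite !ffunE ?permK ?permKV.
apply: eq_big => [psi|psi _].
  by apply: eq_forallb => i; rewrite !ffunE (inj_eq perm_inj).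
congr (_ * _).
  by apply: eq_bigr => u _; rewrite ffunE (eqP (sN _)).
by apply: eq_bigr => e _; rewrite !ffunE (eqP (forallP (sE _) _)).
Qed.

Lemma column_space_invariant (R : realType) (k : nat) (G : wgraph R)
    (f : {ffun {ffun 'I_k -> G} -> R^o}) :
  in_column_space f -> aut_invariant f.
Proof.
case=> Fs; elim: Fs f => [|F Fs IH] f /=.
  by rewrite span_nil memv0 => /eqP-> phi s _; rewrite !ffunE.
rewrite span_cons => /memv_addP[g /vlineP[c ->] [h hFs ->]] phi s sG.
by rewrite !ffunE hom_aut // (IH h hFs).
Qed.

(** * Graphs whose unlabeled nodes form a separate type *)

(** Every [k]-labeled graph is isomorphic to one of this shape; keeping the
    unlabeled nodes in a type of their own turns gluing along labels into a sum
    of types instead of a quotient. *)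
Record ograph (k : nat) := OGraph {
  onode : finType;
  oedge : finType;
  oends : oedge -> ('I_k + onode) * ('I_k + onode);
  oends_neq : forall e, (oends e).1 != (oends e).2
}.

Lemma inl_injective (A B : Type) : injective (@inl A B).
Proof. by move=> x y []. Qed.

Definition klgraph_of_ograph (k : nat) (F : ograph k) : klgraph k :=
  KLGraph (@oends_neq k F) (@inl_injective 'I_k (onode F)).

Definition join (k : nat) (U T : Type) (phi : 'I_k -> T) (theta : U -> T)
    (x : 'I_k + U) : T :=
  match x with inl i => phi i | inr u => theta u end.

Definition ohom (R : realType) (k : nat) (G : wgraph R)
    (phi : {ffun 'I_k -> G}) (F : ograph k) : R :=
  \sum_(theta : {ffun onode F -> G})
    (\prod_u nodewt (theta u)) *
    \prod_(e : oedge F)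
       edgewt (join phi theta (oends e).1) (join phi theta (oends e).2).

Lemma hom_ograph (R : realType) (k : nat) (G : wgraph R)
    (phi : {ffun 'I_k -> G}) (F : ograph k) :
  Defs.hom phi (klgraph_of_ograph F) = ohom phi F.
Proof.
pose ext (theta : {ffun onode F -> G}) : {ffun klgraph_of_ograph F -> G} :=
  [ffun x => join phi theta x].
rewrite /Defs.hom (reindex_onto ext (fun psi => [ffun u => psi (inr u)])); last first.
  move=> psi /forallP psiE; apply/ffunP => -[i|u]; rewrite !ffunE /= ?ffunE //.
  by rewrite (eqP (psiE i)).
apply: eq_big => [theta|theta _].
  apply/andP; split; first by apply/forallP => i; rewrite ffunE.
  by apply/eqP/ffunP => u; rewrite !ffunE.
congr (_ * _); last by apply: eq_bigr => e _; rewrite !ffunE.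
rewrite big_sumType /= big_pred0 => [|i]; last by rewrite codom_f.
rewrite mul1r; apply: eq_big => [u|u _]; last by rewrite ffunE.
by apply/codomP => -[].
Qed.

(** * Operations on graphs *)

Section ColumnAlgebra.
Variables (R : realType) (G : wgraph R).

Definition edgeless (k : nat) : ograph k :=
  @OGraph k void void (fun e => match e with end) (fun e => match e with end).

Lemma ohom_edgeless (k : nat) (phi : {ffun 'I_k -> G}) :
  ohom phi (edgeless k) = 1.
Proof.
rewrite /ohom (big_pred1 (finfun (@of_void G))) => [|theta].
  by rewrite !big_pred0 ?mulr1 //; case.
by symmetry; apply/eqP/ffunP; case.
Qed.

Definition single_edge (k : nat) (i j : 'I_k) (ij : i != j) : ograph k :=
  @OGraph k void unit (fun=> (inl i, inl j)) (fun=> ij).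

Lemma ohom_single_edge (k : nat) (i j : 'I_k) (ij : i != j)
    (phi : {ffun 'I_k -> G}) :
  ohom phi (single_edge ij) = edgewt (phi i) (phi j).
Proof.
rewrite /ohom (big_pred1 (finfun (@of_void G))) => [|theta].
  rewrite big_pred0 ?mul1r; last by case.
  by rewrite (big_pred1 tt) //; case.
by symmetry; apply/eqP/ffunP; case.
Qed.

Definition relabel (k l : nat) (U V : Type) (r : 'I_k + U -> 'I_l + V)
    (p : ('I_k + U) * ('I_k + U)) := (r p.1, r p.2).

Definition glue_l (k : nat) (U V : Type) (x : 'I_k + U) : 'I_k + (U + V) :=
  match x with inl i => inl i | inr u => inr (inl u) end.

Definition glue_r (k : nat) (U V : Type) (x : 'I_k + V) : 'I_k + (U + V) :=
  match x with inl i => inl i | inr u => inr (inr u) end.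

Lemma glue_l_inj (k : nat) (U V : Type) : injective (@glue_l k U V).
Proof. by move=> [x|x] [y|y] // [->]. Qed.

Lemma glue_r_inj (k : nat) (U V : Type) : injective (@glue_r k U V).
Proof. by move=> [x|x] [y|y] // [->]. Qed.

Definition glue_ends (k : nat) (F H : ograph k) (e : oedge F + oedge H) :=
  match e with
  | inl e => relabel (@glue_l k (onode F) (onode H)) (oends e)
  | inr e => relabel (@glue_r k (onode F) (onode H)) (oends e)
  end.

Lemma glue_ends_neq (k : nat) (F H : ograph k) (e : oedge F + oedge H) :
  (glue_ends e).1 != (glue_ends e).2.
Proof.
case: e => e /=; first by rewrite (inj_eq (@glue_l_inj _ _ _)) oends_neq.
by rewrite (inj_eq (@glue_r_inj _ _ _)) oends_neq.
Qed.

Definition glue (k : nat) (F H : ograph k) : ograph k :=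
  OGraph (@glue_ends_neq k F H).

Lemma ohom_glue (k : nat) (F H : ograph k) (phi : {ffun 'I_k -> G}) :
  ohom phi (glue F H) = ohom phi F * ohom phi H.
Proof.
rewrite /ohom big_distrl /=; under [RHS]eq_bigr do rewrite big_distrr /=.
rewrite pair_bigA /=.
pose sumf (p : {ffun onode F -> G} * {ffun onode H -> G}) :
  {ffun onode F + onode H -> G} :=
  [ffun x => match x with inl u => p.1 u | inr u => p.2 u end].
rewrite (reindex sumf) /=; last first.
  exists (fun theta => ([ffun u => theta (inl u)], [ffun u => theta (inr u)])).
    by move=> [p q] _; congr pair; apply/ffunP => u; rewrite !ffunE.
  by move=> theta _; apply/ffunP => -[u|u]; rewrite !ffunE.
apply: eq_bigr => -[p q] _ /=; rewrite !big_sumType /= mulrACA.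
have joinl x : join phi (sumf (p, q)) (glue_l _ x) = join phi p x.
  by case: x => [i|u] //=; rewrite ffunE.
have joinr x : join phi (sumf (p, q)) (glue_r _ x) = join phi q x.
  by case: x => [i|u] //=; rewrite ffunE.
congr (_ * _ * (_ * _)).
- by apply: eq_bigr => u _; rewrite ffunE.
- by apply: eq_bigr => e _; rewrite !joinl.
- by apply: eq_bigr => u _; rewrite ffunE.
- by apply: eq_bigr => e _; rewrite !joinr.
Qed.

Definition extend (k : nat) (T : Type) (phi : {ffun 'I_k -> T}) (v : T) :
    {ffun 'I_k.+1 -> T} :=
  [ffun i => if unlift ord_max i is Some j then phi j else v].

Lemma extend_lift (k : nat) (T : Type) (phi : {ffun 'I_k -> T}) (v : T) i :
  extend phi v (lift ord_max i) = phi i.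
Proof. by rewrite ffunE liftK. Qed.

Lemma extend_max (k : nat) (T : Type) (phi : {ffun 'I_k -> T}) (v : T) :
  extend phi v ord_max = v.
Proof. by rewrite ffunE unlift_none. Qed.

(** The node that loses its label becomes the extra unlabeled node [tt]. *)
Definition forget_last (k : nat) (U : Type) (x : 'I_k.+1 + U) : 'I_k + (unit + U) :=
  match x with
  | inl i => if unlift ord_max i is Some j then inl j else inr (inl tt)
  | inr u => inr (inr u)
  end.

Lemma forget_last_inj (k : nat) (U : Type) : injective (@forget_last k U).
Proof.
move=> [i|u] [j|v] //=; last by case=> ->.
- by case: unliftP => [i' ->|->]; case: unliftP => [j' ->|->] // [->].
- by case: unliftP.
- by case: unliftP.
Qed.

Definition unlabel_ends (k : nat) (F : ograph k.+1) (e : oedge F) :=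
  relabel (@forget_last k (onode F)) (oends e).

Lemma unlabel_ends_neq (k : nat) (F : ograph k.+1) (e : oedge F) :
  (unlabel_ends e).1 != (unlabel_ends e).2.
Proof. by rewrite (inj_eq (@forget_last_inj _ _)) oends_neq. Qed.

Definition unlabel (k : nat) (F : ograph k.+1) : ograph k :=
  OGraph (@unlabel_ends_neq k F).

Lemma ohom_unlabel (k : nat) (F : ograph k.+1) (phi : {ffun 'I_k -> G}) :
  ohom phi (unlabel F) = \sum_v nodewt v * ohom (extend phi v) F.
Proof.
rewrite /ohom; under [RHS]eq_bigr do rewrite big_distrr /=.
rewrite pair_bigA /=.
pose newf (p : G * {ffun onode F -> G}) : {ffun unit + onode F -> G} :=
  [ffun x => match x with inl _ => p.1 | inr u => p.2 u end].
rewrite (reindex newf) /=; last first.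
  exists (fun theta => (theta (inl tt), [ffun u => theta (inr u)])).
    by move=> [v q] _; congr pair; rewrite ?ffunE //; apply/ffunP => u; rewrite !ffunE.
  by move=> theta _; apply/ffunP => -[[]|u]; rewrite !ffunE.
apply: eq_bigr => -[v q] _ /=; rewrite big_sumType /=
  (big_pred1 tt) ?ffunE /= -?mulrA; last by case.
have joinE x : join phi (newf (v, q)) (forget_last x) = join (extend phi v) q x.
  by case: x => [i|u] /=; rewrite ?ffunE //; case: unlift => //=; rewrite ffunE.
congr (_ * (_ * _)).
- by apply: eq_bigr => u _; rewrite ffunE.
- by apply: eq_bigr => e _; rewrite !joinE.
Qed.

(** * The algebra spanned by the columns *)

Definition spanned (k : nat) (f : {ffun 'I_k -> G} -> R) :=
  exists L : seq (R * ograph k), f =1 fun phi => \sum_(p <- L) p.1 * ohom phi p.2.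

Lemma spanned_column_space (k : nat) (f : {ffun {ffun 'I_k -> G} -> R^o}) :
  spanned f -> in_column_space f.
Proof.
case=> L fE; exists [seq klgraph_of_ograph p.2 | p <- L].
have {fE}->: f = [ffun phi => \sum_(p <- L) p.1 * ohom phi p.2].
  by apply/ffunP => phi; rewrite ffunE fE.
elim: L => [|[c F] L IH] /=.
  by rewrite span_nil memv0; apply/eqP/ffunP => phi; rewrite !ffunE big_nil.
rewrite span_cons; apply/memv_addP.
exists (c *: Ncol G (klgraph_of_ograph F)); first by rewrite memvZ ?memv_line.
exists [ffun phi => \sum_(p <- L) p.1 * ohom phi p.2] => //.
by apply/ffunP => phi; rewrite !ffunE big_cons hom_ograph.
Qed.

Lemma spanned_ohom (k : nat) (F : ograph k) : spanned (fun phi => ohom phi F).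
Proof. by exists [:: (1, F)] => phi; rewrite big_seq1 mul1r. Qed.

Lemma spanned_cst (k : nat) (c : R) : spanned (fun _ : {ffun 'I_k -> G} => c).
Proof. by exists [:: (c, edgeless k)] => phi; rewrite big_seq1 ohom_edgeless mulr1. Qed.

Lemma spannedD (k : nat) (f g : {ffun 'I_k -> G} -> R) :
  spanned f -> spanned g -> spanned (fun phi => f phi + g phi).
Proof.
by case=> L fE [M gE]; exists (L ++ M) => phi; rewrite fE gE big_cat.
Qed.

Lemma spannedM (k : nat) (f g : {ffun 'I_k -> G} -> R) :
  spanned f -> spanned g -> spanned (fun phi => f phi * g phi).
Proof.
case=> L fE [M gE].
exists [seq (p.1 * q.1, glue p.2 q.2) | p <- L, q <- M] => phi.
rewrite fE gE big_distrl big_allpairs_dep /=; apply: eq_bigr => p _.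
by rewrite big_distrr; apply: eq_bigr => q _; rewrite /= ohom_glue mulrACA.
Qed.

Lemma spanned_unlabel (k : nat) (f : {ffun 'I_k.+1 -> G} -> R) :
  spanned f -> spanned (fun phi => \sum_v nodewt v * f (extend phi v)).
Proof.
case=> L fE; exists [seq (p.1, unlabel p.2) | p <- L] => phi /=.
under eq_bigr do rewrite fE; rewrite big_map {fE}.
elim: L => [|p L IH]; first by rewrite big_nil big1 // => v _; rewrite big_nil mulr0.
under eq_bigr do rewrite big_cons mulrDr; rewrite big_cons big_split IH /=.
rewrite ohom_unlabel mulr_sumr; congr (_ + _).
by apply: eq_bigr => v _; rewrite mulrCA.
Qed.

(** * Indistinguishable maps *)

Definition indist (k : nat) (phi psi : {ffun 'I_k -> G}) :=
  forall F : ograph k, ohom phi F = ohom psi F.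

Lemma indist_sym (k : nat) (phi psi : {ffun 'I_k -> G}) :
  indist phi psi -> indist psi phi.
Proof. by move=> pp F. Qed.

Lemma indist_spanned_eq (k : nat) (phi psi : {ffun 'I_k -> G}) f :
  indist phi psi -> spanned f -> f phi = f psi.
Proof. by move=> pp [L fE]; rewrite !fE; apply: eq_bigr => p _; rewrite pp. Qed.

(** The indicator function of a class is in the span: it is a product of
    factors [(ohom chi F - ohom psi F) / (ohom phi F - ohom psi F)], as
    functions of [chi], one for each [psi] outside the class, with [F] a graph
    that tells [psi] from [phi]. *)
Lemma indist_indicator (k : nat) (phi : {ffun 'I_k -> G}) :
  exists h, [/\ spanned h, forall psi, indist phi psi -> h psi = 1
    & forall psi, ~ indist phi psi -> h psi = 0].
Proof.
suff [h [hs h1 h0]] : exists h, [/\ spanned h, h phi = 1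
    & forall psi, psi \in enum {ffun 'I_k -> G} -> ~ indist phi psi -> h psi = 0].
  exists h; split=> // psi pp; first by rewrite -(indist_spanned_eq pp hs).
  by apply: h0 => //; rewrite mem_enum.
elim: (enum _) => [|psi s [h [hs h1 h0]]].
  by exists (fun=> 1); split=> //; apply: spanned_cst.
have [pp|/existsNP[F FE]] := pselect (indist phi psi).
  by exists h; split=> // chi; rewrite inE => /orP[/eqP->|/h0].
exists (fun chi => h chi *
  ((ohom phi F - ohom psi F)^-1 * (ohom chi F + - ohom psi F))); split.
- apply: spannedM => //; apply: spannedM; first exact: spanned_cst.
  by apply: spannedD; [apply: spanned_ohom|apply: spanned_cst].
- by rewrite h1 mul1r mulVf // subr_eq0; apply/eqP.
- move=> chi; rewrite inE => /orP[/eqP-> _|chis nchi].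
    by rewrite subrr !mulr0.
  by rewrite h0 // mul0r.
Qed.

(** The values of [f] are corrected on one class after the other: the indicator
    of a class not met so far vanishes at the maps already dealt with. *)
Lemma indist_spanned (k : nat) (f : {ffun 'I_k -> G} -> R) :
  (forall phi psi, indist phi psi -> f phi = f psi) -> spanned f.
Proof.
move=> f_indist.
suff [g gs gE] : exists2 g, spanned g & {in enum {ffun 'I_k -> G}, g =1 f}.
  by have [L gL] := gs; exists L => phi; rewrite -gL gE // mem_enum.
elim: (enum _) => [|phi s [g gs gE]].
  by exists (fun=> 0) => //; apply: spanned_cst.
have [[psi psis pp]|new] := pselect (exists2 psi, psi \in s & indist phi psi).
  exists g => // chi; rewrite inE => /orP[/eqP->|/gE//].
  by rewrite (f_indist _ _ pp) -gE // (indist_spanned_eq pp gs).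
have [h [hs h1 h0]] := indist_indicator phi.
exists (fun chi => g chi + (f phi - g phi) * h chi).
  by apply: spannedD => //; apply: spannedM => //; apply: spanned_cst.
move=> chi; rewrite inE => /orP[/eqP->|chis].
  by rewrite h1 // mulr1 subrKC.
by rewrite h0 ?mulr0 ?addr0 ?gE // => pc; apply: new; exists chi.
Qed.

(** If no extension of [psi] were in the class of [extend phi v], unlabeling
    the indicator of that class would give zero at [psi], but at [phi] it gives
    at least [nodewt v]. *)
Lemma indist_extend (k : nat) (phi psi : {ffun 'I_k -> G}) (v : G) :
  indist phi psi -> exists w, indist (extend phi v) (extend psi w).
Proof.
move=> pp; apply: contrapT => /forallNP no_w.
have [h [hs h1 h0]] := indist_indicator (extend phi v).
have := indist_spanned_eq pp (spanned_unlabel hs).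
rewrite [RHS]big1 => [|w _]; last by rewrite h0 ?mulr0.
rewrite (bigD1 v) //= h1 // mulr1 => sum0.
have : 0 < nodewt v + \sum_(i | i != v) nodewt i * h (extend phi i).
  rewrite ltr_wpDr ?nodewt_gt0 // sumr_ge0 // => i _.
  have [/h1->|/h0->] := pselect (indist (extend phi v) (extend phi i)).
    by rewrite mulr1 ltW ?nodewt_gt0.
  by rewrite mulr0.
by rewrite sum0 ltxx.
Qed.

Lemma indist_edgewt (k : nat) (phi psi : {ffun 'I_k -> G}) (i j : 'I_k) :
  indist phi psi -> i != j -> edgewt (phi i) (phi j) = edgewt (psi i) (psi j).
Proof. by move=> pp ij; have := pp (single_edge ij); rewrite !ohom_single_edge. Qed.

(** The new label is distinct from the old ones, so this form of the edge
    comparison also reaches loops, which no edge between two labels with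
    different images can see. *)
Lemma indist_edgewt_extend (k : nat) (phi psi : {ffun 'I_k -> G}) (v w : G) i :
  indist (extend phi v) (extend psi w) ->
  edgewt (phi i) v = edgewt (psi i) w.
Proof.
move=> pp; have /(indist_edgewt pp) : lift ord_max i != ord_max.
  by rewrite eq_sym neq_lift.
by rewrite !extend_lift !extend_max.
Qed.

(** * Indistinguishable maps differ by an automorphism *)

Hypothesis twinfreeG : twin_free G.

(** [psi i] and [psi j] are twins: to compare their edges to [v], give [v] a
    new label and transfer it to an extension of [phi]. *)
Lemma indist_eq (k : nat) (phi psi : {ffun 'I_k -> G}) (i j : 'I_k) :
  indist phi psi -> phi i = phi j -> psi i = psi j.
Proof.
move=> pp phiE; apply/eqP; apply: contrapT => /negP/twinfreeG; apply=> v.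
have [w qq] := indist_extend v (indist_sym pp).
by rewrite (indist_edgewt_extend i qq) (indist_edgewt_extend j qq) phiE.
Qed.

Lemma indist_extend_eq (k : nat) (phi psi : {ffun 'I_k -> G}) (w : G) i :
  indist (extend phi (phi i)) (extend psi w) -> w = psi i.
Proof.
move=> pp; have := @indist_eq _ _ _ ord_max (lift ord_max i) pp.
by rewrite !extend_lift !extend_max; apply.
Qed.

Lemma indist_surj_aut (k : nat) (phi psi : {ffun 'I_k -> G}) :
  indist phi psi -> (forall u, u \in codom phi) ->
  exists2 s : {perm G}, s \in wgraph_aut G & forall i, psi i = s (phi i).
Proof.
move=> pp phi_surj; pose sf u := psi (iinv (phi_surj u)).
have sfE i : sf (phi i) = psi i by apply: (indist_eq pp); rewrite f_iinv.
have phiP u : exists i, u = phi i by apply/codomP.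
have sf_inj : injective sf.
  move=> u u'; have [[i ->] [j ->]] := (phiP u, phiP u'); rewrite !sfE.
  exact: (indist_eq (indist_sym pp)).
(* So the extension that [indist_extend] provides is determined. *)
have extE u w : indist (extend phi u) (extend psi w) -> w = sf u.
  by have [i ->] := phiP u; rewrite sfE; apply: indist_extend_eq.
exists (perm sf_inj); last by move=> i; rewrite permE sfE.
rewrite inE; apply/andP; split; apply/forallP => u; last first.
  apply/forallP => v; rewrite !permE; have [i ->] := phiP u.
  have [w qq] := indist_extend v pp.
  by rewrite sfE -(extE _ _ qq) (indist_edgewt_extend i qq).
have [w qq] := indist_extend u pp; have wE := extE _ _ qq.
have [h [hs h1 h0]] := indist_indicator (extend phi u).
have := indist_spanned_eq pp (spanned_unlabel hs).
rewrite (bigD1 u) //= [RHS](bigD1 w) //= !h1 // !mulr1 !big1 ?addr0 => [-> | v vw | v vu].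
- by rewrite permE wE.
- by rewrite h0 ?mulr0 // => /extE vE; rewrite vE wE eqxx in vw.
rewrite h0 ?mulr0 //; have [i uE] := phiP u; rewrite uE => /indist_extend_eq vE.
by rewrite vE uE eqxx in vu.
Qed.

(** Labels are added until every node of [G] carries one. *)
Lemma indist_aut (k : nat) (phi psi : {ffun 'I_k -> G}) :
  indist phi psi ->
  exists2 s : {perm G}, s \in wgraph_aut G & forall i, psi i = s (phi i).
Proof.
have : forall u, (u \in enum G) || (u \in codom phi).
  by move=> u; rewrite mem_enum.
elim: (enum G) k phi psi => [|u s IH] k phi psi cover pp.
  exact: indist_surj_aut.
have [w qq] := indist_extend u pp.
have cover' v : (v \in s) || (v \in codom (extend phi u)).
  apply/orP; have := cover v; rewrite inE -orbA => /or3P[/eqP->|->|/codomP[i ->]].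
  - by right; rewrite -{1}(extend_max phi u) codom_f.
  - by left.
  - by right; rewrite -(extend_lift phi u i) codom_f.
have [t tG tE] := IH _ _ _ cover' qq.
by exists t => // i; have := tE (lift ord_max i); rewrite !extend_lift.
Qed.

End ColumnAlgebra.

Theorem lemma2p5 (R : realType) (k : nat) (hk : (1 <= k)%N)
    (G : wgraph R) (hG : twin_free G)
    (f : {ffun {ffun 'I_k -> G} -> R^o}) :
  in_column_space f <-> aut_invariant f.
Proof.
split; first exact: column_space_invariant.
move=> f_inv; apply: spanned_column_space; apply: indist_spanned => phi psi pp.
have [s sG sE] := indist_aut hG pp.
by rewrite -(f_inv phi s sG); congr (f _); apply/ffunP => i; rewrite ffunE sE.
Qed.
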